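(* For every finite, simple, and undirected graph $G$ of maximum degree $\Delta\ge 1$, its acyclic chromatic number satisfies $$A(G)\le\bigl\lceil\,20.571\;\Delta\,(\sqrt[3]{\Delta}+1)\,\bigr\rceil.$$
   Context: A coloring of the vertices of $G$ is proper if no two adjacent vertices are assigned the same color. It is acyclic if it is proper and contains no bichromatic cycle (equivalently, every cycle in $G$ receives at least three colors). The acyclic chromatic number $A(G)$ is the minimum number of colors required for an acyclic coloring of $G$. *)

(* Defs.v *)
From HB Require Import structures.
From mathcomp Require Import all_boot all_order all_algebra.
From mathcomp Require Import all_classical all_reals all_analysis.

Set Implicit Arguments.
Unset Strict Implicit.
Unset Printing Implicit Defensive.

Record sgraph := SGraph {
  vertex :> finType;
  adj : rel vertex;
  adj_sym : symmetric adj;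
  adj_irrefl : irreflexive adj }.

Definition degree (G : sgraph) (v : G) : nat := #|[set w | adj v w]|.

Definition max_degree (G : sgraph) : nat := \max_(v : G) degree v.

(* [path.cycle] alone also holds for [::] and for [:: x; y] with x, y adjacent,
   hence the lower bound on the size. *)
Definition graph_cycle (G : sgraph) (c : seq G) : bool :=
  [&& 2 < size c, uniq c & cycle (@adj G) c].

Definition proper_coloring (G : sgraph) (C : eqType) (f : G -> C) : Prop :=
  forall x y : G, adj x y -> f x != f y.

Definition bichromatic (G : sgraph) (C : eqType) (f : G -> C) (c : seq G)
    : bool :=
  size (undup (map f c)) == 2.

Definition acyclic_coloring (G : sgraph) (C : eqType) (f : G -> C) : Prop :=
  proper_coloring f /\
  ~ (exists c : seq G, graph_cycle c /\ bichromatic f c).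

Definition acyclic_colorable (G : sgraph) (k : nat) : Prop :=
  exists f : G -> 'I_k, acyclic_coloring f.

Lemma ex_acyclic_colorable (G : sgraph) :
  exists k, `[< acyclic_colorable G k >].
Proof.
exists #|G|; apply/asboolP; exists enum_rank; split=> [x y xy|].
  by apply/eqP => /enum_rank_inj exy; rewrite exy adj_irrefl in xy.
move=> [c [/and3P[c2 uc _]]].
rewrite /bichromatic undup_id ?(map_inj_uniq enum_rank_inj)// size_map.
by move=> /eqP c2E; rewrite c2E in c2.
Qed.

Definition acyclic_chromatic_number (G : sgraph) : nat :=
  ex_minn (ex_acyclic_colorable G).

(* Main.v *)
(* Rosenfeld's counting method. Let q be least with Delta <= q^3, put m = Delta q,
   and call two vertices special when they have more than q^2 common neighbours;
   a vertex has at most Delta^2 / q^2 <= m special partners. A coloring is acyclic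
   as soon as adjacent or special vertices get different colors, no 4-cycle has
   both of its (non-special) diagonals monochromatic, and no path on five vertices
   is 2-colored. With 7 m colors, the number N(S) of such colorings of the subgraph
   induced by S satisfies N(S + v) >= 4 m N(S), by induction on S. Indeed, of the
   7 m N(S) one-vertex extensions, those violating a condition made of k equations
   of colors are determined by their restriction to S minus k - 1 vertices, hence
   number at most N(S) / (4 m)^(k - 1); and v lies in at most 2 m conditions with
   k = 1, Delta^2 q^2 = m^2 with k = 2, and 3 Delta^4 <= 3 m^3 with k = 3, which
   excludes at most (2 + 1/4 + 3/16) m N(S) <= 3 m N(S) extensions. *)
Require Import Defs.
From mathcomp Require Import all_boot all_order all_algebra.
From mathcomp Require Import all_classical all_reals all_analysis.
From mathcomp Require Import fintype finset zify lra.
Import Order.TTheory GRing.Theory Num.Theory.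

Set Implicit Arguments.
Unset Strict Implicit.
Unset Printing Implicit Defensive.

(** * Partial colorings that avoid patterns of color equalities *)

Lemma card_le_sum_cover (X : finType) (I : eqType) (s : seq I)
    (B : I -> {set X}) (A : {set X}) :
  (forall x, x \in A -> exists2 i, i \in s & x \in B i) ->
  #|A| <= \sum_(i <- s) #|B i|.
Proof.
elim: s A => [|i s IHs] A cover.
  rewrite big_nil leqn0 cards_eq0; apply/eqP/setP => x; rewrite inE.
  by apply/negP => /cover[].
rewrite big_cons -(cardsID (B i) A); apply: leq_add.
  by apply/subset_leq_card/subsetIr.
apply: IHs => x; rewrite inE => /andP[xNi /cover[j]].
rewrite inE => /orP[/eqP-> xi|js xj]; last by exists j.
by rewrite xi in xNi.
Qed.

Section EqualityPatterns.
Variables (T C : finType) (F : seq (T * T) -> Prop).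
Implicit Types (f g : {ffun T -> option C}) (S U : {set T}) (v x y : T)
  (e : seq (T * T)).

(** Two uncolored vertices do not agree, so [avoids] constrains a partial coloring only on patterns
    whose vertices are all colored. *)
Definition agree f (p : T * T) : bool := isSome (f p.1) && (f p.1 == f p.2).

Definition avoids f : bool := `[< forall e, F e -> ~~ all (agree f) e >].

Definition colored f : {set T} := [set x | isSome (f x)].

Definition avoiding S : {set {ffun T -> option C}} :=
  [set f | (colored f == S) && avoids f].

Definition erase U f : {ffun T -> option C} :=
  [ffun x => if x \in U then None else f x].

Definition extensions S v : {set {ffun T -> option C}} :=
  [set f | (colored f == v |: S) && avoids (erase [set v] f)].

(* In a rooted pattern the colors of the left-hand vertices can be recovered
   from the colors of the remaining vertices. *)
Definition rooted v e : bool :=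
  [&& uniq (unzip1 e), v \in unzip1 e
    & all (fun y => y \notin unzip1 e) (unzip2 e)].

Lemma agree_erase U f p : agree (erase U f) p -> agree f p.
Proof.
rewrite /agree !ffunE; case: ifP => // _; case: ifP => // _.
by case: (f p.1).
Qed.

Lemma avoids_erase U f : avoids f -> avoids (erase U f).
Proof.
move=> /asboolP avf; apply/asboolP => e /avf; apply: contra.
by apply: sub_all => p; apply: agree_erase.
Qed.

Lemma colored_erase U f : colored (erase U f) = colored f :\: U.
Proof. by apply/setP => x; rewrite !inE ffunE; case: ifP. Qed.

Lemma erase_erase U U' f : erase U (erase U' f) = erase (U :|: U') f.
Proof.
apply/ffunP => x; rewrite !ffunE inE.
by case: (x \in U); case: (x \in U').
Qed.

Lemma avoiding0 : (forall e, F e -> e != [::]) -> 0 < #|avoiding set0|.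
Proof.
move=> Fn0; apply/card_gt0P; exists [ffun=> None]; rewrite inE.
apply/andP; split; first by apply/eqP/setP => x; rewrite !inE ffunE.
by apply/asboolP => -[|p e] /Fn0 //= _; rewrite /agree ffunE.
Qed.

(** Painting [v] with an arbitrary color extends an avoiding coloring of [S]; the pair is recovered
    by reading the color of [v] and erasing it. *)
Lemma card_extensions S v : v \notin S ->
  #|avoiding S| * #|C| <= #|extensions S v|.
Proof.
move=> vNS; rewrite -[#|C|]cardsT -cardsX.
pose paint (u : {ffun T -> option C} * C) : {ffun T -> option C} :=
  [ffun x => if x == v then Some u.2 else u.1 x].
have erase_paint u : colored u.1 = S -> erase [set v] (paint u) = u.1.
  move=> uS; apply/ffunP => x; rewrite !ffunE inE; case: eqP => // xv.
  by move: vNS; rewrite -uS inE -xv; case: (u.1 x).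
have paint_inj : {in setX (avoiding S) setT &, injective paint}.
  move=> [u a] [w b]; rewrite !inE !andbT => /andP[/eqP uS _] /andP[/eqP wS _].
  move=> uw; have uw1 : u = w by rewrite -[u](erase_paint (u, a))// uw erase_paint.
  have := congr1 (fun h : {ffun T -> option C} => h v) uw.
  by rewrite !ffunE eqxx uw1 => -[->].
rewrite -(card_in_imset paint_inj); apply/subset_leq_card/subsetP => _ /imsetP[u + ->].
rewrite !inE andbT => /andP[/eqP uS avu]; rewrite erase_paint// avu andbT.
by apply/eqP/setP => x; rewrite -uS !inE ffunE; case: (x == v).
Qed.

Lemma erase_id v f e : v \notin unzip1 e ++ unzip2 e ->
  all (agree f) e -> all (agree (erase [set v] f)) e.
Proof.
rewrite mem_cat negb_or => /andP[v1 v2] /allP fe; apply/allP => p pe.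
have := fe _ pe; rewrite /agree !ffunE !inE.
have /negPf-> : p.1 != v by apply: contraNneq v1 => <-; apply: map_f.
by have /negPf-> : p.2 != v by apply: contraNneq v2 => <-; apply: map_f.
Qed.

(** A violated pattern that does not involve [v] would still be violated after erasing [v]. *)
Lemma extension_bad S v f : f \in extensions S v -> f \notin avoiding (v |: S) ->
  exists e, [/\ F e, all (agree f) e & v \in unzip1 e ++ unzip2 e].
Proof.
rewrite !inE => /andP[-> /asboolP avv] /= /asboolPn/existsNP[e].
move=> /not_implyP[Fe /negP]; rewrite negbK => fe; exists e; split=> //.
by apply: contraT => ve; have := avv e Fe; rewrite erase_id.
Qed.

(* [pats v] lists, rooted at [v], the patterns of [F] that involve [v]; the weight
   hypothesis is [beta + \sum_e beta ^ (1 - size e) <= #|C|] cleared of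
   denominators. *)
Section Growth.
Variables (beta D : nat) (pats : T -> seq (seq (T * T))).
Hypothesis beta_gt0 : 0 < beta.
Hypothesis F_cover : forall v e f, F e -> v \in unzip1 e ++ unzip2 e ->
  all (agree f) e -> exists2 e', e' \in pats v & all (agree f) e'.
Hypothesis pats_rooted : forall v e, e \in pats v -> rooted v e.
Hypothesis pats_size : forall v e, e \in pats v -> size e <= D.+1.
Hypothesis pats_weight : forall v,
  beta ^ D.+1 + \sum_(e <- pats v) beta ^ (D.+1 - size e) <= beta ^ D * #|C|.

(** * Growth of the number of avoiding colorings *)

Lemma avoiding_shrink S (s : seq T) :
  (forall S' v, #|S'| < #|S| -> v \notin S' ->
     beta * #|avoiding S'| <= #|avoiding (v |: S')|) ->
  uniq s -> {subset s <= S} ->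
  beta ^ size s * #|avoiding (S :\: [set x in s])| <= #|avoiding S|.
Proof.
elim: s S => [|x s IHs] S IH /=.
  rewrite mul1n => _ _; rewrite (_ : S :\: _ = S)//.
  by apply/setP => x; rewrite !inE.
move=> /andP[xs us] sS.
have xS : x \in S by apply: sS; rewrite mem_head.
have sD : #|S :\ x| < #|S| by rewrite [ltnRHS](cardsD1 x) xS.
apply: leq_trans (_ : beta * #|avoiding (S :\ x)| <= _); last first.
  by rewrite -[S in leqRHS](setD1K xS); apply: IH => //; rewrite !inE eqxx.
rewrite expnS -mulnA leq_mul2l; apply/orP; right.
rewrite (_ : S :\: _ = (S :\ x) :\: [set y in s]); last first.
  by apply/setP => y; rewrite !inE negb_or -andbA andbCA andbA.
apply: IHs => // [S' v S'S|y ys]; first by apply: IH; apply: ltn_trans S'S sD.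
rewrite !inE sS ?inE ?ys ?orbT// andbT.
by apply: contraNneq xs => <-.
Qed.

(** On the extensions counted here, the colors of [unzip1 e] are copies of colors of right-hand
    vertices, so erasing [unzip1 e] is injective. The result is an avoiding coloring of [S] minus
    [(size e).-1] vertices, and [avoiding_shrink] compares the number of these with [avoiding S].
    Growth is assumed only below [S], as the induction of [avoiding_grow] provides it. *)
Lemma card_bad_extensions S v e :
  (forall S' v, #|S'| < #|S| -> v \notin S' ->
     beta * #|avoiding S'| <= #|avoiding (v |: S')|) ->
  v \notin S -> rooted v e ->
  beta ^ (size e).-1 * #|[set f in extensions S v | all (agree f) e]|
    <= #|avoiding S|.
Proof.
move=> IH vS /and3P[ue ve /allP e2].
set B := [set f in _ | _]; have [->|[f0]] := set_0Vmem B.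
  by rewrite cards0 muln0.
have BP f : f \in B -> [/\ colored f = v |: S, avoids (erase [set v] f)
                         & all (agree f) e].
  by rewrite !inE => /andP[/andP[/eqP]].
(* One bad extension [f0] suffices to see that the left-hand vertices other than [v] lie in [S]: it
   colors them all. *)
move=> /BP[f0S _ /allP f0e].
pose s := rem v (unzip1 e).
have us : uniq s by rewrite rem_uniq.
have sE x : (x \in s) = (x != v) && (x \in unzip1 e).
  by rewrite mem_rem_uniq// !inE.
have sz : size s = (size e).-1 by rewrite size_rem// size_map.
have sS : {subset s <= S}.
  move=> x; rewrite sE => /andP[xv /mapP[p pe xp]].
  have : x \in colored f0 by rewrite inE xp; case/andP: (f0e _ pe).
  by rewrite f0S !inE (negPf xv).
apply: leq_trans (avoiding_shrink IH us sS); rewrite sz leq_mul2l; apply/orP; right.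
pose U := [set x in unzip1 e].
have inj : {in B &, injective (erase U)}.
  move=> f g /BP[_ _ /allP fe] /BP[_ _ /allP ge] fg; apply/ffunP => x.
  have eqNU y : y \notin U -> f y = g y.
    move=> yU; have := congr1 (fun h : {ffun T -> option C} => h y) fg.
    by rewrite !ffunE (negPf yU).
  have [xU|] := boolP (x \in U); last exact: eqNU.
  move: xU; rewrite inE => /mapP[p pe ->].
  have /andP[_ /eqP->] := fe _ pe; have /andP[_ /eqP->] := ge _ pe.
  by apply: eqNU; rewrite inE; apply/e2/map_f.
rewrite -(card_in_imset inj); apply/subset_leq_card/subsetP => _ /imsetP[f fB ->].
have [fS avf _] := BP _ fB.
(* As [v] is in [U], erasing [U] can start by erasing [v], which already gives an avoiding
   coloring. *)
have vU : [set v] \subset U by rewrite sub1set inE.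
rewrite inE colored_erase fS -(setUidPl vU) -erase_erase avoids_erase// andbT.
apply/eqP/setP => x; rewrite !inE sE; case: (eqVneq x v) => [->|] /=.
  by rewrite ve (negPf vS).
by rewrite orbF.
Qed.

(** Strong induction on the size of [S]: every extension either avoids [F] or satisfies a pattern of
    [pats v]. The union bound and [pats_weight] leave at least [beta * #|avoiding S|] good
    extensions. *)
Lemma avoiding_grow S v : v \notin S ->
  beta * #|avoiding S| <= #|avoiding (v |: S)|.
Proof.
have [n] := ubnP #|S|; elim: n S v => // n IHn S v Sn vS.
have IH S' w : #|S'| < #|S| -> w \notin S' ->
    beta * #|avoiding S'| <= #|avoiding (w |: S')|.
  by move=> S'S; apply: IHn; apply: leq_trans S'S _; rewrite -ltnS.
pose B e := [set f in extensions S v | all (agree f) e].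
have cover : #|extensions S v| <=
    #|avoiding (v |: S)| + \sum_(e <- pats v) #|B e|.
  rewrite -(cardsID (avoiding (v |: S)) (extensions S v)); apply: leq_add.
    by apply/subset_leq_card/subsetIr.
  apply: card_le_sum_cover => f; rewrite inE => /andP[fNav fext].
  have [e [Fe fe ve]] := extension_bad fext fNav.
  have [e' e'v fe'] := F_cover Fe ve fe.
  by exists e' => //; rewrite inE fext.
have bad : beta ^ D * (\sum_(e <- pats v) #|B e|) <=
    (\sum_(e <- pats v) beta ^ (D.+1 - size e)) * #|avoiding S|.
  rewrite big_distrr big_distrl /= big_seq [leqRHS]big_seq; apply: leq_sum => e ev.
  (* Rootedness makes [e] nonempty; with [pats_size], neither [(size e).-1] nor [D.+1 - size e] is
     then truncated, and the two exponents add up to [D]. *)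
  have ge0 : 0 < size e.
    by have /and3P[_ + _] := pats_rooted ev; case: (e).
  have De := pats_size ev.
  rewrite (_ : beta ^ D = beta ^ (D.+1 - size e) * beta ^ (size e).-1); last first.
    by rewrite -expnD; case: (size e) ge0 De => [//|k] _ kD; rewrite subSS subnK.
  rewrite -mulnA.
  by rewrite leq_mul2l (card_bad_extensions IH vS (pats_rooted ev)) orbT.
rewrite -(leq_pmul2l (_ : 0 < beta ^ D)) ?expn_gt0 ?beta_gt0//.
have := leq_mul (leqnn #|avoiding S|) (pats_weight v).
have := leq_mul (leqnn (beta ^ D)) (leq_trans (card_extensions vS) cover).
rewrite expnS; move: bad; move: (\sum_(e <- _) _) (\sum_(e <- _) _) => a b.
move: (beta ^ D) (#|avoiding S|) (#|avoiding (v |: S)|) (#|C|) => p N N' c.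
by rewrite !mulnDr => bad1 H1 H2; nia.
Qed.

(** Growth from the empty set keeps every [avoiding S] nonempty; a member of [avoiding setT] never
    takes the value [None]. *)
Lemma avoiding_coloring : (forall e, F e -> e != [::]) ->
  exists f : T -> C, forall e, F e -> ~~ all (fun p => f p.1 == f p.2) e.
Proof.
move=> Fn0.
have av_gt0 S : 0 < #|avoiding S|.
  have [n] := ubnP #|S|; elim: n S => // n IHn S Sn.
  have [->|[x xS]] := set_0Vmem S; first exact: avoiding0.
  rewrite -(setD1K xS).
  apply: leq_trans (avoiding_grow (_ : x \notin S :\ x)); last by rewrite !inE eqxx.
  rewrite muln_gt0 beta_gt0 IHn//.
  by move: Sn; rewrite (cardsD1 x) xS.
have /card_gt0P[f] := av_gt0 setT; rewrite inE => /andP[/eqP fT /asboolP avf].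
have fS x : isSome (f x) by have := in_setT x; rewrite -fT inE.
have fE x : {c | f x = Some c} by case: (f x) (fS x) => // c _; exists c.
exists (fun x => sval (fE x)) => e /avf; apply: contra; apply: sub_all => p /=.
rewrite /agree fS /=; case: (fE p.1) (fE p.2) => [a fa] [b fb] /= /eqP ab.
by rewrite fa fb ab.
Qed.

End Growth.
End EqualityPatterns.

(** * Forbidden patterns for acyclic colorings *)

Section ForbiddenPatterns.
Variables (G : sgraph) (q : nat).
Implicit Types (v w x y a b c d u : G) (e : seq (G * G)).

Definition nbr v : {set G} := [set w | adj v w].

Definition special x y : bool := (x != y) && (q ^ 2 < #|nbr x :&: nbr y|).

(** In [Path5] the color classes are [a], [c], [u] and [b], [d]: two classes on five vertices amount
    to three equations. [Square] can ask for non-special diagonals because [Clash] already separates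
    special pairs. *)
Inductive forbidden : seq (G * G) -> Prop :=
| Clash x y of adj x y || special x y : forbidden [:: (x, y)]
| Square x y z w of [&& adj x y, adj y z, adj z w & adj w x]
    & uniq [:: x; y; z; w] & ~~ special x z & ~~ special y w :
    forbidden [:: (x, z); (y, w)]
| Path5 a b c d u of path (@adj G) a [:: b; c; d; u]
    & uniq [:: a; b; c; d; u] : forbidden [:: (a, u); (b, d); (c, u)].

Lemma adj_neq x y : adj x y -> x != y.
Proof. by apply: contraTneq => ->; rewrite adj_irrefl. Qed.

Lemma special_sym : symmetric special.
Proof. by move=> x y; rewrite /special eq_sym setIC. Qed.

Lemma bichromatic_eq (C : eqType) (c : seq C) (x y z : C) : size (undup c) = 2 ->
  x \in c -> y \in c -> z \in c -> x != y -> y != z -> x = z.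
Proof.
move=> c2 xc yc zc xy yz; apply/eqP/contraT => xz.
have : size [:: x; y; z] <= size (undup c).
  apply: uniq_leq_size; first by rewrite /= !inE negb_or xy xz yz.
  by move=> t; rewrite !inE mem_undup => /or3P[]/eqP->.
by rewrite c2.
Qed.

(** Colors alternate along a bichromatic cycle. A triangle would then have two adjacent vertices of
    one color, a 4-cycle is a [Square] or has a special diagonal, and a longer cycle starts with a
    [Path5]. *)
Lemma avoiding_acyclic (C : eqType) (f : G -> C) :
  (forall e, forbidden e -> ~~ all (fun p => f p.1 == f p.2) e) ->
  acyclic_coloring f.
Proof.
move=> avf.
have clash x y : adj x y || special x y -> f x != f y.
  by move=> /Clash/avf; rewrite /= andbT.
have prop x y : adj x y -> f x != f y by move=> xy; rewrite clash ?xy.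
split=> // -[c [/and3P[c3 uc cc] /eqP c2]].
have eq2 x y z : x \in c -> y \in c -> z \in c -> adj x y -> adj y z -> f x = f z.
  by move=> xc yc zc xy yz; apply: (bichromatic_eq c2 (y := f y)); rewrite ?map_f ?prop.
case: c c3 uc cc {c2} eq2 => [|x [|y [|z [|w [|u s]]]]] // _ uc.
- move=> /and4P[xy yz zx _] /(_ x y z) eq2.
  by have := prop _ _ zx; rewrite eq2 ?eqxx ?inE ?eqxx ?orbT.
- move=> /= /and5P[xy yz zw wx _] eq2.
  have xz : f x = f z by apply: (eq2 x y z); rewrite ?inE ?eqxx ?orbT.
  have yw : f y = f w by apply: (eq2 y z w); rewrite ?inE ?eqxx ?orbT.
  have nsp a b : f a = f b -> ~~ special a b.
    move=> ab; apply/negP => sp; have := clash a b.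
    by rewrite sp orbT ab eqxx => /(_ isT).
  have := avf _ (Square _ uc (nsp _ _ xz) (nsp _ _ yw)).
  by rewrite xy yz zw wx /= xz yw !eqxx => /(_ isT).
move=> /= /and5P[xy yz zw wu _] eq2.
have xz : f x = f z by apply: (eq2 x y z); rewrite ?inE ?eqxx ?orbT.
have yw : f y = f w by apply: (eq2 y z w); rewrite ?inE ?eqxx ?orbT.
have zu : f z = f u by apply: (eq2 z w u); rewrite ?inE ?eqxx ?orbT.
have := @avf [:: (x, u); (y, w); (z, u)].
rewrite /= xz zu yw !eqxx => /(_ _)/negP[]//.
apply: Path5 => /=; first by rewrite xy yz zw wu.
by have := take_uniq 5 uc; rewrite /= take0.
Qed.

(** * The patterns through a given vertex *)

Definition clashes v : {set G} := [set w | adj v w] :|: [set w | special v w].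

Definition squares v : {set G * G * G} :=
  [set t | let: (a, b, c) := t in
    [&& adj v a, adj a b, v != b, ~~ special v b, c \in nbr v :&: nbr b & a != c]].

(** Up to reversal of the path, [v] is its end, its second vertex or its middle. In these three
    families each component is adjacent to [v] or to an earlier component, which bounds its choices
    by the maximum degree. *)
Definition paths_from_end v : {set G * G * G * G} :=
  [set t | let: (b, c, d, u) := t in
    [&& adj v b, adj b c, adj c d, adj d u & uniq [:: v; b; c; d; u]]].

Definition paths_from_second v : {set G * G * G * G} :=
  [set t | let: (a, c, d, u) := t in
    [&& adj v a, adj v c, adj c d, adj d u & uniq [:: a; v; c; d; u]]].

Definition paths_from_middle v : {set G * G * G * G} :=
  [set t | let: (b, a, d, u) := t in
    [&& adj v b, adj b a, adj v d, adj d u & uniq [:: a; b; v; d; u]]].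

(** On the right stands one vertex other than [v] from each color class; all others are on the left,
    so the patterns are rooted at [v]. *)
Definition patterns_at v : seq (seq (G * G)) :=
  [seq [:: (v, w)] | w <- enum (clashes v)] ++
  [seq let: (a, b, c) := t in [:: (v, b); (a, c)] | t <- enum (squares v)] ++
  [seq let: (b, c, d, u) := t in [:: (v, u); (b, d); (c, u)]
     | t <- enum (paths_from_end v)] ++
  [seq let: (a, c, d, u) := t in [:: (v, d); (a, u); (c, u)]
     | t <- enum (paths_from_second v)] ++
  [seq let: (b, a, d, u) := t in [:: (v, u); (a, u); (b, d)]
     | t <- enum (paths_from_middle v)].

Lemma mem_clash v w : w \in clashes v -> [:: (v, w)] \in patterns_at v.
Proof. by move=> vw; rewrite !mem_cat map_f// mem_enum. Qed.

Lemma mem_square v a b c : (a, b, c) \in squares v ->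
  [:: (v, b); (a, c)] \in patterns_at v.
Proof.
move=> t; rewrite !mem_cat; apply/orP; right; apply/orP; left.
by apply/mapP; exists (a, b, c); rewrite ?mem_enum.
Qed.

Lemma mem_end v b c d u : (b, c, d, u) \in paths_from_end v ->
  [:: (v, u); (b, d); (c, u)] \in patterns_at v.
Proof.
move=> t; rewrite !mem_cat; do 2!(apply/orP; right); apply/orP; left.
by apply/mapP; exists (b, c, d, u); rewrite ?mem_enum.
Qed.

Lemma mem_second v a c d u : (a, c, d, u) \in paths_from_second v ->
  [:: (v, d); (a, u); (c, u)] \in patterns_at v.
Proof.
move=> t; rewrite !mem_cat; do 3!(apply/orP; right); apply/orP; left.
by apply/mapP; exists (a, c, d, u); rewrite ?mem_enum.
Qed.

Lemma mem_middle v b a d u : (b, a, d, u) \in paths_from_middle v ->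
  [:: (v, u); (a, u); (b, d)] \in patterns_at v.
Proof.
move=> t; rewrite !mem_cat; do 4!(apply/orP; right).
by apply/mapP; exists (b, a, d, u); rewrite ?mem_enum.
Qed.

Lemma patterns_atP v e : e \in patterns_at v ->
  [\/ exists2 w, w \in clashes v & e = [:: (v, w)],
      exists a b c, (a, b, c) \in squares v /\ e = [:: (v, b); (a, c)],
      exists b c d u, (b, c, d, u) \in paths_from_end v /\
        e = [:: (v, u); (b, d); (c, u)] |
      (exists a c d u, (a, c, d, u) \in paths_from_second v /\
        e = [:: (v, d); (a, u); (c, u)]) \/
      (exists b a d u, (b, a, d, u) \in paths_from_middle v /\
        e = [:: (v, u); (a, u); (b, d)])].
Proof.
rewrite !mem_cat => /or4P[/mapP[w]|/mapP[[[a b] c]]|/mapP[[[[b c] d] u]]|/orP[]].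
- by rewrite mem_enum => ? ->; constructor 1; exists w.
- by rewrite mem_enum => ? ->; constructor 2; exists a, b, c.
- by rewrite mem_enum => ? ->; constructor 3; exists b, c, d, u.
- move=> /mapP[[[[a c] d] u]]; rewrite mem_enum => ? ->.
  by constructor 4; left; exists a, c, d, u.
- move=> /mapP[[[[b a] d] u]]; rewrite mem_enum => ? ->.
  by constructor 4; right; exists b, a, d, u.
Qed.

Lemma patterns_at_size v e : e \in patterns_at v -> size e <= 3.
Proof.
by case/patterns_atP => [[w _ ->]|[a [b [c [_ ->]]]]|[b [c [d [u [_ ->]]]]]
  |[[a [c [d [u [_ ->]]]]]|[b [a [d [u [_ ->]]]]]]].
Qed.

Lemma patterns_at_rooted v e : e \in patterns_at v -> rooted v e.
Proof.
case/patterns_atP => [[w vw ->]|[a [b [c [t ->]]]]|[b [c [d [u [t ->]]]]]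
  |[[a [c [d [u [t ->]]]]]|[b [a [d [u [t ->]]]]]]].
- move: vw; rewrite /rooted /= !inE eqxx andbT /= => /orP[/adj_neq|/andP[]].
    by rewrite eq_sym.
  by rewrite eq_sym.
- move: t; rewrite !inE => /and5P[/adj_neq va /adj_neq ab vb _].
  move=> /andP[/andP[/adj_neq vc /adj_neq bc] ac].
  rewrite /rooted /= !inE !negb_or eqxx /= !andbT va.
  by rewrite [b == v]eq_sym vb [b == a]eq_sym ab [c == v]eq_sym vc
             [c == a]eq_sym ac.
all: move: t; rewrite inE => /and5P[_ _ _ _];
  rewrite /rooted /= !inE !negb_or eqxx ?orbT !andbT;
  repeat first [move=> /andP[] | move=> ?];
  repeat (apply/andP; split); by [|rewrite eq_sym].
Qed.

Lemma agree_sym (K : finType) (f : {ffun G -> option K}) x y :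
  agree f (x, y) -> agree f (y, x).
Proof. by rewrite /agree /= => /andP[fx /eqP <-]; rewrite fx eqxx. Qed.

Lemma agree_trans (K : finType) (f : {ffun G -> option K}) x y z :
  agree f (x, y) -> agree f (y, z) -> agree f (x, z).
Proof. by rewrite /agree /= => /andP[fx /eqP <-] /andP[_ /eqP <-]; rewrite fx eqxx. Qed.

(** Clashes are symmetric, squares can be rotated to start at [v], and paths can be reversed. *)
Lemma patterns_at_cover (K : finType) v e (f : {ffun G -> option K}) :
  forbidden e -> v \in unzip1 e ++ unzip2 e -> all (agree f) e ->
  exists2 e', e' \in patterns_at v & all (agree f) e'.
Proof.
case=> [x y xy|x y z w /and4P[xy yz zw wx] u4 spxz spyw|a b c d u p5 u5] /=.
- rewrite !inE andbT => /orP[]/eqP-> fxy.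
    by exists [:: (x, y)]; rewrite ?mem_clash ?inE //= fxy.
  exists [:: (y, x)]; last by rewrite /= agree_sym.
  by rewrite mem_clash// !inE adj_sym special_sym.
- have sq v1 v2 v3 v4 : adj v1 v2 -> adj v2 v3 -> adj v3 v4 -> adj v4 v1 ->
    uniq [:: v1; v2; v3; v4] -> ~~ special v1 v3 ->
    [:: (v1, v3); (v2, v4)] \in patterns_at v1.
    move=> a12 a23 a34 a41; rewrite /= !inE !negb_or.
    move=> /and4P[/and3P[_ n13 _] /andP[_ n24] _ _].
    move=> sp; rewrite mem_square// !inE a12 a23 n13 sp n24.
    by rewrite [adj v1 v4]adj_sym a41 a34.
  rewrite !inE andbT => vin /andP[xz yw].
  have rot4 v1 v2 v3 v4 : uniq [:: v1; v2; v3; v4] -> uniq [:: v2; v3; v4; v1].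
    by rewrite -(rot_uniq 1).
  have u4' := rot4 _ _ _ _ u4; have u4'' := rot4 _ _ _ _ u4'.
  have u4''' := rot4 _ _ _ _ u4''.
  case/or4P: vin => /eqP->.
  + by exists [:: (x, z); (y, w)]; [exact: sq|rewrite /= xz yw].
  + exists [:: (y, w); (z, x)]; first exact: sq.
    by rewrite /= yw agree_sym.
  + exists [:: (z, x); (w, y)]; first by rewrite sq// special_sym.
    by rewrite /= (agree_sym xz) (agree_sym yw).
  + exists [:: (w, y); (x, z)]; first by rewrite sq// special_sym.
    by rewrite /= xz agree_sym.
have rev5 : path (@adj G) u [:: d; c; b; a] /\ uniq [:: u; d; c; b; a].
  split; last by rewrite -rev_uniq.
  move: p5 => /and5P[ab bc cd du _].
  by rewrite /= adj_sym du adj_sym cd adj_sym bc adj_sym ab.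
have pE v1 v2 v3 v4 v5 : path (@adj G) v1 [:: v2; v3; v4; v5] ->
    uniq [:: v1; v2; v3; v4; v5] ->
    [/\ [:: (v1, v5); (v2, v4); (v3, v5)] \in patterns_at v1,
        [:: (v2, v4); (v1, v5); (v3, v5)] \in patterns_at v2 &
        [:: (v3, v5); (v1, v5); (v2, v4)] \in patterns_at v3].
  move=> /and5P[a12 a23 a34 a45 _] u5'; split.
  - by apply: mem_end; rewrite inE a12 a23 a34 a45.
  - by apply: mem_second; rewrite inE adj_sym a12 a23 a34 a45.
  - by apply: mem_middle; rewrite inE adj_sym a23 adj_sym a12 a34 a45.
have [pa pb pc] := pE _ _ _ _ _ p5 u5.
have [pu pd _] := pE _ _ _ _ _ rev5.1 rev5.2.
rewrite !inE => vin /and4P[au bd cu _].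
(* The reversed path represents its class of three by [a] instead of [u], so its third equation
   comes from transitivity. *)
have ca := agree_trans cu (agree_sym au).
have : [|| v == a, v == b, v == c, v == d | v == u].
  by move: vin; do 5!case: eqP => //=.
case/or4P=> [/eqP->|/eqP->|/eqP->|/orP[]/eqP->].
- by exists [:: (a, u); (b, d); (c, u)]; rewrite //= au bd cu.
- by exists [:: (b, d); (a, u); (c, u)]; rewrite //= au bd cu.
- by exists [:: (c, u); (a, u); (b, d)]; rewrite //= au bd cu.
- by exists [:: (d, b); (u, a); (c, a)]; rewrite //= ca (agree_sym au) (agree_sym bd).
- by exists [:: (u, a); (d, b); (c, a)]; rewrite //= ca (agree_sym au) (agree_sym bd).
Qed.

(** * Counting the patterns at a vertex *)

Section Weights.
Variable Delta : nat.
Hypothesis degree_le : forall v, degree v <= Delta.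
Hypothesis Delta_le_q3 : Delta <= q ^ 3.

Lemma card_nbr v : #|nbr v| <= Delta.
Proof. exact: degree_le. Qed.

Lemma card_fibration (X Y : finType) (A : {set X * Y}) (A' : {set X})
    (W : X -> {set Y}) m :
  (forall p, p \in A -> p.1 \in A' /\ p.2 \in W p.1) ->
  (forall z : X, z \in A' -> #|W z| <= m) -> #|A| <= #|A'| * m.
Proof.
move=> AP Wm.
apply: leq_trans (_ : \sum_(z | (z : X) \in A') #|W z| <= _); last first.
  by rewrite -sum_nat_const; apply: leq_sum.
under eq_bigr do rewrite -sum1_card.
rewrite pair_big_dep /= sum1_card; apply/subset_leq_card/subsetP => p /AP[p1 p2].
by rewrite unfold_in /= p1 p2.
Qed.

Lemma card_step (X : finType) (A : {set X * G}) (g : X -> G) :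
  (forall p, p \in A -> adj (g p.1) p.2) -> #|A| <= #|[set p.1 | p in A]| * Delta.
Proof.
move=> AP; apply: (card_fibration (W := fun z : X => nbr (g z))) => [p pA|x _].
  by rewrite inE AP//; split=> //; apply: imset_f.
exact: card_nbr.
Qed.

(** The functions [g2], [g3], [g4] select an already known vertex adjacent to the next component; a
    constant function selects [v]. *)
Lemma card_walks4 (A : {set G * G * G * G}) v (g2 : G -> G) (g3 : G * G -> G)
    (g4 : G * G * G -> G) :
  (forall p1 p2 p3 p4, (p1, p2, p3, p4) \in A ->
    [/\ adj v p1, adj (g2 p1) p2, adj (g3 (p1, p2)) p3 & adj (g4 (p1, p2, p3)) p4]) ->
  #|A| <= Delta ^ 4.
Proof.
move=> AP; have := card_step (A := A) (g := g4); rewrite !expnSr expn0 mul1n.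
move=> /(_ _)/leq_trans-> //; first by move=> [[[p1 p2] p3] p4] /AP[].
rewrite leq_mul2r; apply/orP; right.
apply: leq_trans (card_step (g := g3) _) _.
  by move=> _ /imsetP[[[[p1 p2] p3] p4] /AP[? ? ? ?] ->].
rewrite leq_mul2r; apply/orP; right.
apply: leq_trans (card_step (g := g2) _) _.
  by move=> _ /imsetP[_ /imsetP[[[[p1 p2] p3] p4] /AP[? ? ? ?] ->] ->].
rewrite leq_mul2r; apply/orP; right.
apply: leq_trans (card_nbr v); apply/subset_leq_card/subsetP.
move=> _ /imsetP[_ /imsetP[_ /imsetP[[[[p1 p2] p3] p4] /AP[? ? ? ?] ->] ->] ->].
by rewrite inE.
Qed.

Lemma card_paths v : [/\ #|paths_from_end v| <= Delta ^ 4,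
  #|paths_from_second v| <= Delta ^ 4 & #|paths_from_middle v| <= Delta ^ 4].
Proof.
split.
- apply: (@card_walks4 _ v id snd snd) => a b c d.
  by rewrite inE => /and5P[].
- apply: (@card_walks4 _ v (fun=> v) snd snd) => a b c d.
  by rewrite inE => /and5P[].
- apply: (@card_walks4 _ v id (fun=> v) snd) => a b c d.
  by rewrite inE => /and5P[].
Qed.

(** There are at most [Delta ^ 2] walks from [v] through [a] to [b]; as [v] and [b] are not special,
    at most [q ^ 2] vertices [c] close the square. *)
Lemma card_squares v : #|squares v| <= Delta ^ 2 * q ^ 2.
Proof.
pose A' := [set p : G * G | [&& adj v p.1, adj p.1 p.2, v != p.2 & ~~ special v p.2]].
have A'D : #|A'| <= Delta ^ 2.
  apply: (leq_trans (card_fibration (A' := nbr v) (W := nbr) (m := Delta) _ _)).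
  - by move=> p; rewrite !inE => /and4P[].
  - by move=> x _; apply: card_nbr.
  by rewrite leq_mul2r card_nbr orbT.
apply: leq_trans (leq_mul A'D (leqnn _)).
apply: (card_fibration (W := fun p => nbr v :&: nbr p.2)).
  move=> [[a b] c]; rewrite inE => /and5P[? ? ? ? /andP[? _]].
  by rewrite inE; split=> //; apply/and4P.
by move=> p; rewrite inE => /and4P[_ _ vp]; rewrite /special vp -leqNgt.
Qed.

(* Double counting the walks of length two from [v]. *)
Lemma card_special v : 0 < q -> #|[set w | special v w]| <= Delta * q.
Proof.
move=> q0.
suff sp2 : #|[set w | special v w]| * q ^ 2 <= Delta * Delta.
  have q2 : 0 < q ^ 2 by rewrite expn_gt0 q0.
  rewrite -(leq_pmul2r q2); apply: leq_trans sp2 _.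
  by rewrite -mulnA leq_mul2l -expnS Delta_le_q3 orbT.
rewrite -sum_nat_const.
apply: leq_trans (_ : \sum_w #|nbr v :&: nbr w| <= _).
  rewrite [leqRHS](bigID (fun w => w \in [set w | special v w])) /=.
  apply: leq_trans (leq_addr _ _); apply: leq_sum => w.
  by rewrite inE => /andP[_ /ltnW].
apply: leq_trans (_ : \sum_(x in nbr v) #|nbr x| <= _); last first.
  apply: leq_trans (_ : \sum_(x in nbr v) Delta <= _).
    by apply: leq_sum => x _; apply: card_nbr.
  by rewrite sum_nat_const leq_mul2r card_nbr orbT.
under eq_bigr do rewrite -sum1_card.
under [leqRHS]eq_bigr do rewrite -sum1_card.
rewrite (exchange_big_dep (mem (nbr v))) /=; last first.
  by move=> w x _; rewrite inE => /andP[].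
apply: eq_leq; apply: eq_bigr => x xv; apply: eq_bigl => w.
by rewrite in_setI xv !inE adj_sym.
Qed.

(** This is [pats_weight] for [beta = 4 * m], [D = 2] and [7 * m] colors. In units of [m ^ 3] the
    left side is at most 64 + 32 + 4 + 3 = 103, and the right side is 112. *)
Lemma patterns_at_weight v : 0 < q -> 0 < Delta ->
  (4 * (Delta * q)) ^ 3 +
    \sum_(e <- patterns_at v) (4 * (Delta * q)) ^ (3 - size e)
  <= (4 * (Delta * q)) ^ 2 * (7 * (Delta * q)).
Proof.
move=> q0 D0; set m := Delta * q.
rewrite !big_cat !big_map !big_enum /=.
have cst (X : finType) (A : {set X}) (h : X -> nat) n :
    (forall z : X, h z = n) -> \sum_(z | z \in A) h z = #|A| * n.
  by move=> hn; rewrite (eq_bigr (fun=> n))// sum_nat_const.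
rewrite (cst _ _ _ ((4 * m) ^ 2))// (cst _ (squares v) _ (4 * m)); last by case=> [[]].
rewrite !(cst _ _ _ 1); try by case=> [[[]]].
have clm : #|clashes v| <= Delta + m.
  apply: leq_trans (leq_card_setU _ _) _.
  by apply: leq_add (card_nbr v) (card_special v q0).
have sqm : #|squares v| <= m ^ 2 by rewrite expnMn card_squares.
have D4 : Delta ^ 4 <= m ^ 3 by rewrite expnMn expnSr leq_mul2l Delta_le_q3 orbT.
have Dm : Delta <= m by rewrite leq_pmulr.
have [pa pb pc] := card_paths v.
move: clm sqm (leq_trans pa D4) (leq_trans pb D4) (leq_trans pc D4) Dm.
rewrite !muln1 !expnS expn0 !muln1.
move: #|clashes v| #|squares v| #|paths_from_end v| #|paths_from_second v|
  #|paths_from_middle v| => n1 n2 n3 n4 n5 clm sqm p1 p2 p3 Dm.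
have : n1 * (m * m) <= 2 * m * (m * m) by rewrite leq_mul2r; lia.
have : n2 * m <= m * m * m by rewrite leq_mul2r sqm orbT.
lia.
Qed.

Lemma acyclic_colorable_7 : 0 < q -> 0 < Delta ->
  acyclic_colorable G (7 * (Delta * q)).
Proof.
move=> q0 D0.
have [|||f avf] := @avoiding_coloring G 'I_(7 * (Delta * q)) forbidden
  (4 * (Delta * q)) 2 patterns_at _ (@patterns_at_cover _) patterns_at_rooted
  patterns_at_size.
- by rewrite !muln_gt0 D0 q0.
- by move=> v; rewrite card_ord; apply: patterns_at_weight.
- by move=> e [].
by exists f; apply: avoiding_acyclic.
Qed.

End Weights.
End ForbiddenPatterns.

(** * From the integer cube root to the real bound *)

Lemma ceil_cube_root (Delta : nat) : 0 < Delta ->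
  exists2 q, Delta <= q ^ 3 & 0 < q /\ q.-1 ^ 3 <= Delta.
Proof.
move=> D0; have ex_q : exists q, Delta <= q ^ 3.
  by exists Delta; rewrite -[leqLHS]expn1 leq_pexp2l.
case: (ex_minnP ex_q) => q Dq qmin; exists q => //.
have q0 : 0 < q by case: q Dq {qmin} => //; rewrite leqNgt D0.
split=> //; rewrite leqNgt; apply/negP => /ltnW/qmin.
by rewrite -ltnS prednK// ltnn.
Qed.

Local Open Scope ring_scope.

Theorem proposition2 (R : realType) (G : sgraph) (Delta : nat)
    (maxdeg : max_degree G = Delta) (Delta_ge1 : (1 <= Delta)%N) :
  ((acyclic_chromatic_number G)%:Z <=
   Num.ceil (20571 / 1000 * Delta%:R * (Delta%:R `^ 3^-1 + 1) : R))%R.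
Proof.
have [q Dq [q0 qD]] := ceil_cube_root Delta_ge1.
have degD (v : G) : (degree v <= Delta)%N by rewrite -maxdeg; apply: leq_bigmax.
have col := acyclic_colorable_7 degD Dq q0 Delta_ge1.
have Ak : (acyclic_chromatic_number G <= 7 * (Delta * q))%N.
  by rewrite /acyclic_chromatic_number; case: ex_minnP => k _; apply; apply/asboolP.
(* Take real cube roots in [q.-1 ^ 3 <= Delta]. *)
have qR : q%:R <= Delta%:R `^ 3^-1 + 1 :> R.
  rewrite -(prednK q0) -natr1 lerD2r.
  have -> : q.-1%:R = (q.-1 ^ 3)%:R `^ 3^-1 :> R.
    by rewrite natrX -powR_mulrn// -powRrM mulfV// powRr1.
  by apply: ge0_ler_powR; rewrite ?nnegrE ?invr_ge0 ?ler0n ?ler_nat.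
(* An integer is its own ceiling, so comparing the real numbers suffices; the constant only has to
   satisfy 7 <= 20.571. *)
rewrite -[(_)%:Z](@intrKceil R); apply: le_ceil.
apply: (@le_trans _ _ (7 * (Delta * q))%:R); first by rewrite ler_nat.
rewrite !natrM mulrA; apply: ler_pM; rewrite ?mulr_ge0 ?ler0n//.
by apply: ler_pM => //; lra.
Qed.
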